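(* For $n\ge 0$ let $W_n(q)=\sum_{k=0}^n\binom{n}{k}^2q^k$. The polynomials $W_n(q)$ form a $q$-log-convex sequence $\{W_n(q)\}_{n\ge 0}$.
   Context: A sequence $\{f_n(q)\}_{n\geq 0}$ of polynomials with real coefficients is called $q$-log-convex if for every $k\geq 1$ the difference $f_{k+1}(q)f_{k-1}(q)-f_k(q)^2$ has nonnegative coefficients as a polynomial in $q$. *)

(* Defs.v *)
From mathcomp Require Import all_boot all_order all_algebra.
From mathcomp Require Import reals.

Set Implicit Arguments.
Unset Strict Implicit.
Unset Printing Implicit Defensive.

Import Order.TTheory GRing.Theory Num.Theory.
Local Open Scope ring_scope.

(* The variable q is 'X, and p`_i is the coefficient of q^i in p. *)
Definition q_log_convex (R : realType) (f : nat -> {poly R}) : Prop :=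
  forall k : nat, (1 <= k)%N ->
  forall i : nat, 0 <= (f k.+1 * f k.-1 - f k ^+ 2)`_i.

Definition W (R : realType) (n : nat) : {poly R} :=
  \sum_(0 <= k < n.+1) ('C(n, k) ^ 2)%:R *: 'X^k.

(* Main.v *)
Require Import Defs.
From mathcomp Require Import all_boot all_order all_algebra.
From mathcomp Require Import reals.
From mathcomp Require Import zify ring.

(** Why the theorem holds.  Put q = r^2.  Since 'C(n, k) = 'C(n, n - k),
    W_n(r^2) is the constant term in z of A(z)^n, where
        A(z) = (1 + r z)(1 + r / z) = 1 + r^2 + r (z + 1/z).
    Symmetrising in two variables z and w, W_{n+2} W_n - W_{n+1}^2 is half
    the constant term of (A(z) A(w))^n (A(z) - A(w))^2.

    Now substitute z = x y and w = x / y.  Then (A(z) - A(w))^2 becomes r^2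
    times (x - 1/x)^2 (y - 1/y)^2, four times the Weyl density of SL2 x SL2,
    so W_{n+2} W_n - W_{n+1}^2 is 2 r^2 times the multiplicity of the trivial
    character in (A(z) A(w))^n.  On the other hand
        A(z) A(w) = 1 + r^4 + (r + r^3) U1(x) U1(y) + r^2 (U2(x) + U2(y)),
    with U1(x) = x + 1/x and U2(x) = x^2 + 1 + 1/x^2, is a character with
    nonnegative coefficients (it is the graded character of the exterior
    algebra of the tensor product of the two standard representations).
    Hence so are its powers, and every multiplicity is nonnegative.

    The proof below carries this out with coefficients only.  [step_coef n i]
    is the coefficient of z^i in A^n.  The multiplicity [mult n a b] is the
    alternating sum of four products of these given by the Weyl character
    formula, (a, b) being exponents of z and w.  It obeys a linear recurrence
    in n (lemma [multS]) and is antisymmetric under the two shifted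
    reflections (lemmas [mult_refl] and [mult_oppr]); inside the dominant chamber
    |b| <= a these two facts turn the recurrence into one with nonnegative
    coefficients (lemma [mult_nneg]).  Lemma [step_coef_turan] then expresses
    the difference of the theorem through [mult n 0 0]. *)

Set Implicit Arguments.
Unset Strict Implicit.
Unset Printing Implicit Defensive.

Import Order.TTheory GRing.Theory Num.Theory.
Local Open Scope ring_scope.

(** The variable 'X of {poly R} plays the role of r, the square root of q. *)
Fixpoint step_coef (R : comNzRingType) (n : nat) (i : int) : {poly R} :=
  if n is m.+1 then
    (1 + 'X ^+ 2) * step_coef R m i
      + 'X * (step_coef R m (i - 1) + step_coef R m (i + 1))
  else (i == 0)%:R.

(** The coefficient of x^(a + b) y^(a - b) in
    (1 - x^-2) (1 - y^-2) (A(x y) A(x / y))^n; by the Weyl character formula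
    it is the multiplicity of the irreducible character of highest weight
    (a + b, a - b) when |b| <= a. *)
Definition mult (R : comNzRingType) (n : nat) (a b : int) : {poly R} :=
  step_coef R n a * step_coef R n b
  - step_coef R n (a + 1) * step_coef R n (b + 1)
  - step_coef R n (a + 1) * step_coef R n (b - 1)
  + step_coef R n (a + 2) * step_coef R n b.

Section StepCoef.
Variable R : comNzRingType.
Local Notation c := (step_coef R).
Local Notation M := (mult R).

Lemma step_coefS n i :
  c n.+1 i = (1 + 'X ^+ 2) * c n i + 'X * (c n (i - 1) + c n (i + 1)).
Proof. by []. Qed.

Lemma step_coefN n i : c n (- i) = c n i.
Proof.
elim: n i => [|n IH] i; first by rewrite /= oppr_eq0.
rewrite !step_coefS IH -(IH (i - 1)) -(IH (i + 1)).
by rewrite opprB opprD (addrC 1 (- i)) (addrC (c n (- i - 1))).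
Qed.

Lemma step_coef_out n (i : int) : i < - n%:Z -> c n i = 0.
Proof.
elim: n i => [|n IH] i lti /=; first by case: eqP => // i0; lia.
by rewrite !IH ?addr0 ?mulr0 ?addr0 //; lia.
Qed.

(** The constant term W_n(r^2) is read off from z^n A^n, an honest
    polynomial in z with a Cauchy product for its coefficients. *)
Lemma coef_step_poly n k :
  (((1 + 'X%:P * 'X) * ('X + 'X%:P)) ^+ n : {poly {poly R}})`_k
  = c n (k%:Z - n%:Z).
Proof.
have -> : (1 + 'X%:P * 'X) * ('X + 'X%:P)
   = 'X%:P + (1 + 'X ^+ 2)%:P * 'X + 'X%:P * 'X * 'X :> {poly {poly R}}.
  rewrite polyCD polyCM; ring.
elim: n k => [|n IH] k; first by rewrite expr0 coef1 subr0.
set p : {poly {poly R}} := _ + _ + _ in IH *.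
have -> : p ^+ n.+1 = 'X%:P * p ^+ n + (1 + 'X ^+ 2)%:P * (p ^+ n * 'X)
    + 'X%:P * (p ^+ n * 'X * 'X).
  rewrite exprS {1}/p; ring.
rewrite !(coefD, coefCM, coefMX) step_coefS.
case: k => [|[|k]] /=.
- rewrite IH !mulr0 !addr0.
  rewrite (step_coef_out (i := 0 - n.+1%:Z)) ?(step_coef_out (i := _ - 1)); try lia.
  by rewrite mulr0 !add0r; congr (_ * c n _); lia.
- rewrite !IH mulr0 addr0 (step_coef_out (i := _ - 1)); last lia.
  have -> : 1%N%:Z - n.+1%:Z + 1 = 1%N%:Z - n%:Z by lia.
  have -> : 1%N%:Z - n.+1%:Z = 0%N%:Z - n%:Z by lia.
  by rewrite !add0r addrC.
rewrite !IH mulrDr.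
have -> : k.+2%:Z - n.+1%:Z + 1 = k.+2%:Z - n%:Z by lia.
have -> : k.+2%:Z - n.+1%:Z - 1 = k%:Z - n%:Z by lia.
have -> : k.+2%:Z - n.+1%:Z = k.+1%:Z - n%:Z by lia.
ring.
Qed.

Lemma step_coef0E n :
  c n 0 = \sum_(0 <= k < n.+1) ('C(n, k) ^ 2)%:R *: 'X ^+ (2 * k).
Proof.
rewrite -(subrr n%:Z) -coef_step_poly exprMn coefM big_mkord.
apply: eq_bigr => i _.
have hi : (i <= n)%N by rewrite -ltnS.
have -> : ((1 + 'X%:P * 'X) ^+ n : {poly {poly R}})`_i = 'X ^+ i *+ 'C(n, i).
  have -> : (1 + 'X%:P * 'X) ^+ n
      = \poly_(k < n.+1) ('X ^+ k *+ 'C(n, k)) :> {poly {poly R}}.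
    rewrite exprDn poly_def; apply: eq_bigr => k _.
    by rewrite expr1n mul1r exprMn -polyC_exp mul_polyC scalerMnl.
  by rewrite coef_poly ltnS hi.
have -> : (('X + 'X%:P) ^+ n : {poly {poly R}})`_(n - i) = 'X ^+ i *+ 'C(n, i).
  have -> : ('X + 'X%:P) ^+ n
      = \poly_(k < n.+1) ('X ^+ (n - k) *+ 'C(n, k)) :> {poly {poly R}}.
    rewrite addrC exprDn poly_def; apply: eq_bigr => k _.
    by rewrite -polyC_exp mul_polyC scalerMnl.
  by rewrite coef_poly ltnS leq_subr subKn // bin_sub.
rewrite mulrnAl mulrnAr -mulrnA -exprD addnn -mul2n.
by rewrite scaler_nat mulnn.
Qed.

Lemma step_coef_turan n :
  c n.+2 0 * c n 0 - c n.+1 0 ^+ 2 = 2%:R * 'X ^+ 2 * M n 0 0.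
Proof.
rewrite /mult !step_coefS !(add0r, sub0r) !subrr.
have -> : c n (-1 - 1) = c n 2 by rewrite -(step_coefN n 2).
have -> : 1 + 1 = 2 :> int by [].
rewrite step_coefN; ring.
Qed.

Lemma mult_oppr n a b : M n a (- b) = M n a b.
Proof.
rewrite /mult step_coefN -(step_coefN n (- b + 1)) -(step_coefN n (- b - 1)).
by rewrite !opprD !opprK; ring.
Qed.

Lemma mult_refl n a b : M n (-1 - b) (-1 - a) = - M n a b.
Proof.
rewrite /mult.
have -> : -1 - b = - (b + 1) by lia.
have -> : -1 - a = - (a + 1) by lia.
have -> : - (b + 1) + 1 = - b by lia.
have -> : - (a + 1) + 1 = - a by lia.
have -> : - (a + 1) - 1 = - (a + 2) by lia.
have -> : - (b + 1) + 2 = - (b - 1) by lia.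
rewrite !step_coefN; ring.
Qed.

Lemma multS n a b :
  M n.+1 a b =
    (1 + 'X ^+ 2) ^+ 2 * M n a b
    + 'X * (1 + 'X ^+ 2)
      * (M n (a - 1) b + M n (a + 1) b + M n a (b - 1) + M n a (b + 1))
    + 'X ^+ 2 * (M n (a - 1) (b - 1) + M n (a - 1) (b + 1)
                 + M n (a + 1) (b - 1) + M n (a + 1) (b + 1)).
Proof.
rewrite /mult !step_coefS.
have -> : a + 1 - 1 = a by lia.
have -> : a - 1 + 1 = a by lia.
have -> : a - 1 + 2 = a + 1 by lia.
have -> : a + 2 - 1 = a + 1 by lia.
have -> : a + 1 + 1 = a + 2 by lia.
have -> : a + 1 + 2 = a + 2 + 1 by lia.
have -> : b + 1 - 1 = b by lia.
have -> : b - 1 + 1 = b by lia.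
ring.
Qed.

End StepCoef.

Section Nonnegativity.
Variable R : numDomainType.
Local Notation M := (mult R).
Local Notation nneg := (polyOver (@Num.Def.nneg_num_pred R)).

(** The shifted reflection fixes the wall a + b = -1 pointwise and negates
    [mult], which therefore vanishes there. *)
Lemma mult_wall n a b : a + b = -1 -> M n a b = 0.
Proof.
move=> hab; have := mult_refl R n a b.
have -> : -1 - b = a by lia.
have -> : -1 - a = b by lia.
move=> /eqP; rewrite -addr_eq0 -mulr2n -mulr_natl -polyC_natr mulf_eq0.
by rewrite polyC_eq0 pnatr_eq0 => /eqP.
Qed.

Lemma mult_wallN n a b : a - b = -1 -> M n a b = 0.
Proof. by move=> hab; rewrite -mult_oppr; apply: mult_wall. Qed.

(** The only steps leaving the chamber |b| <= a that do not end on a wall are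
    the diagonal ones.  One such step from a + b = 0 is the mirror image of
    staying put, so adding one copy of [mult n a b] compensates it. *)
Lemma mult_diag_step n a b :
  (forall a b : int, 0 <= a + b -> 0 <= a - b -> M n a b \is a nneg) ->
  0 <= a + b -> 0 <= a - b -> M n a b + M n (a - 1) (b - 1) \is a nneg.
Proof.
move=> IH hp hm.
have [h0|[h1|h2]] : a + b = 0 \/ a + b = 1 \/ 2 <= a + b by lia.
- have -> : a - 1 = -1 - b by lia.
  have -> : b - 1 = -1 - a by lia.
  by rewrite mult_refl subrr rpred0.
- by rewrite (mult_wall n (a := a - 1)) ?addr0 ?IH //; lia.
- by rewrite rpredD ?IH //; lia.
Qed.

(** In [multS] the coefficient (1 + r^2)^2 = 1 + r^4 + 2 r^2 has exactly the
    two copies of r^2 required to compensate the diagonal steps across the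
    two walls of the chamber. *)
Lemma mult_nneg n (a b : int) :
  0 <= a + b -> 0 <= a - b -> M n a b \is a nneg.
Proof.
elim: n a b => [|n IH] a b hp hm.
  rewrite /mult /=.
  have -> : (a + 1 == 0) = false by apply/eqP; lia.
  have -> : (a + 2 == 0) = false by apply/eqP; lia.
  by rewrite !mul0r !subr0 addr0 -natrM rpred_nat.
have wall x y : -1 <= x + y -> -1 <= x - y -> M n x y \is a nneg.
  move=> hx hy; have [h|h] : x + y = -1 \/ 0 <= x + y by lia.
    by rewrite mult_wall ?rpred0.
  have [h'|h'] : x - y = -1 \/ 0 <= x - y by lia.
    by rewrite mult_wallN ?rpred0.
  exact: IH.
(* The two walls are exchanged by b -> - b, under which [mult] is even. *)
have dg1 : M n a b + M n (a - 1) (b - 1) \is a nneg by apply: mult_diag_step.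
have dg2 : M n a b + M n (a - 1) (b + 1) \is a nneg.
  have := @mult_diag_step n a (- b) IH; rewrite opprK => /(_ hm hp).
  by rewrite -opprD !mult_oppr.
have -> : M n.+1 a b =
    (1 + 'X ^+ 4) * M n a b
    + 'X * (1 + 'X ^+ 2)
      * (M n (a - 1) b + M n (a + 1) b + M n a (b - 1) + M n a (b + 1))
    + 'X ^+ 2 * ((M n a b + M n (a - 1) (b - 1))
                 + (M n a b + M n (a - 1) (b + 1))
                 + M n (a + 1) (b - 1) + M n (a + 1) (b + 1)).
  rewrite multS; ring.
by rewrite !(dg1, dg2, wall, rpredD, rpredM, rpredX, rpred1, polyOverX) //; lia.
Qed.

End Nonnegativity.

Lemma W_comp_sqr (R : realType) n : W R n \Po 'X ^+ 2 = step_coef R n 0.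
Proof.
rewrite /W step_coef0E raddf_sum; apply: eq_bigr => k _ /=.
by rewrite comp_polyZ comp_Xn_poly exprM.
Qed.

Theorem theorem1p1 (R : realType) : q_log_convex (W R).
Proof.
move=> [//|n] _ i /=.
set D := _ - _.
have DE : D \Po 'X ^+ 2 = 2%:R * 'X ^+ 2 * mult R n 0 0.
  by rewrite rmorphB rmorphM rmorphXn /= !W_comp_sqr step_coef_turan.
have -> : D`_i = (D \Po 'X ^+ 2)`_(i * 2).
  by rewrite coef_comp_poly_Xn // dvdn_mull // mulnK.
have : D \Po 'X ^+ 2 \is a polyOver (@Num.Def.nneg_num_pred R).
  by rewrite DE !(rpredM, rpredX, polyOverX, rpred_nat) // mult_nneg.
by move=> /polyOverP /(_ (i * 2)%N); rewrite nnegrE.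
Qed.
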